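(* Given an arrangement of $n$ $d$-dimensional flats in $\mathbb{R}^{2d}$ such that no two flats are parallel. If the number of pairs with zero dimensional (single point) intersection is $o(n^2)$, then one can remove $o(n)$ flats such that the intersections of the remaining pairs have dimension at least one.
   Context: A $d$-dimensional flat in $\mathbb{R}^{2d}$ is a $d$-dimensional affine subspace. Parallel has its usual meaning: two $d$-dimensional flats are parallel if one is a translate of the other. For two functions over the reals, $f(x)$ and $g(x)$, one writes $f(x)=o(g(x))$ if $f(x)/g(x)\to 0$ as $x\to\infty$; here $d$ is fixed and the asymptotics are in the number $n$ of flats, as $n\to\infty$.
   Formalization: ''The intersections of the remaining pairs have dimension at least one'' is claimed only for remaining pairs that do intersect; disjoint pairs must be allowed, as planes ℓ_i × R in R^4 over pairwise skew lines ℓ_i of R^3 show. *)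

(* Defs.v *)
From mathcomp Require Import all_boot all_order all_algebra.
From mathcomp Require Import boolp classical_sets reals.

Set Implicit Arguments.
Unset Strict Implicit.
Unset Printing Implicit Defensive.
Import GRing.Theory Num.Theory.
Local Open Scope ring_scope.
Local Open Scope classical_set_scope.

(* The empty set is not a flat of any dimension. *)
Definition is_flat (R : realType) (m k : nat) (A : set 'rV[R]_m) : Prop :=
  exists (p : 'rV[R]_m) (U : {vspace 'rV[R]_m}),
    \dim U = k /\ A = [set x | x - p \in U].

Definition parallel (R : realType) (m : nat) (A B : set 'rV[R]_m) : Prop :=
  exists v : 'rV[R]_m, B = [set x + v | x in A].

(* The strict order on indices makes each unordered pair count once. *)
Definition point_pairs (R : realType) (m n : nat)
    (F : 'I_n -> set 'rV[R]_m) : nat :=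
  #|[pred ij : 'I_n * 'I_n |
      (ij.1 < ij.2)%N && `[< is_flat 0 (F ij.1 `&` F ij.2) >]]|.

(* Main.v *)
(* Two d-flats of R^(2d) with directions U and W meet in a single point exactly
   when U and W are complementary, that is, when the determinant of a basis of U
   stacked on a basis of W is nonzero. Every term of the Leibniz formula is a
   function of U times a function of W, so the n x n matrix M of these
   determinants has rank at most (2d)!, independently of n. A matrix of rank r
   with E nonzero entries vanishes off few indices: at most sqrt E rows have more
   than sqrt E nonzero entries, and once they are deleted, r of the remaining
   rows span the others, so at most r sqrt E columns are nonzero. Counting the
   diagonal as well, E is at most 2 f(n) + n = o(n^2). *)
Require Import Defs.
From mathcomp Require Import all_boot all_order all_algebra.
From mathcomp Require Import boolp classical_sets filter reals topology normedtype.
From mathcomp Require Import perm realfun sequences ring.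
Import Order.TTheory GRing.Theory Num.Theory numFieldNormedType.Exports.
Local Open Scope ring_scope.

(** A column that vanishes on a maximal independent set of rows vanishes on every row, so the
    nonzero columns lie in the union of the supports of [\rank M] rows. *)
Lemma card_support_rank (K : fieldType) (m n t : nat) (M : 'M[K]_(m, n)) :
  (forall i, #|[set j | M i j != 0%R]| <= t)%N ->
  (#|[set j | [exists i, M i j != 0%R]]| <= \rank M * t)%N.
Proof.
move=> rowt.
pose e := maxrankfun M.
have sub : [set j | [exists i, M i j != 0]] \subset
    \bigcup_(k < \rank M) [set j | M (e k) j != 0].
  apply/fintype.subsetP => j; rewrite inE => /existsP[i]; apply: contraNT => jN.
  have /submxP[D eqD] : (row i M <= rowsub e M)%MS by rewrite eq_maxrowsub row_sub.
  have -> : M i j = (row i M) 0 j by rewrite mxE.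
  rewrite eqD mxE big1// => k _; rewrite mxE; apply/eqP; rewrite mulf_eq0.
  apply/orP; right; apply: contraNT jN => Mkj.
  by apply/finset.bigcupP; exists k; rewrite ?inE.
apply: (leq_trans (subset_leq_card sub)).
apply: (@leq_trans (\sum_(k < \rank M) #|[set j | M (e k) j != 0%R]|)%N).
  elim/big_ind2: _ => [|A a B b Aa Bb|//]; first by rewrite cards0.
  by rewrite (leq_trans (leq_card_setU _ _))// leq_add.
rewrite -[X in (_ <= X * _)%N]card_ord -sum_nat_const.
exact: leq_sum.
Qed.

Lemma nat_sqrt (m : nat) : exists t, (t ^ 2 <= m < t.+1 ^ 2)%N.
Proof.
elim: m => [|m [t /andP[le lt]]]; first by exists 0%N.
have [lt'|ge] := ltnP m.+1 (t.+1 ^ 2)%N.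
  by exists t; rewrite (leq_trans le).
by exists t.+1; rewrite ge (leq_ltn_trans lt)// ltn_exp2r.
Qed.

(** The factor [(\rank M).+1] collects 1 for the deleted rows and [\rank M] for the columns still
    nonzero afterwards; squaring keeps the bound in the naturals. *)
Lemma sparse_low_rank_removal (K : fieldType) (n : nat) (M : 'M[K]_n) :
  exists S : {set 'I_n},
    (#|S| ^ 2 <= (\rank M).+1 ^ 2 *
                 #|[set ij : 'I_n * 'I_n | M ij.1 ij.2 != 0%R]|)%N /\
    forall i j, i \notin S -> j \notin S -> M i j = 0.
Proof.
set E := #|_|.
have [t /andP[leE ltE]] := nat_sqrt E.
pose deg i := #|[set j | M i j != 0%R]|.
pose B := [set i | (t < deg i)%N].
(* Left multiplication by this 0/1 diagonal matrix clears the rows in [B] and cannot raise the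
   rank. *)
pose D : 'M[K]_n := diag_mx (\row_i (i \notin B)%:R).
have DM i j : (D *m M) i j = (i \notin B)%:R * M i j.
  by rewrite mul_diag_mx !mxE.
pose C := [set j | [exists i, (D *m M) i j != 0]].
have cardB : (#|B| <= t)%N.
  have sE : E = (\sum_i deg i)%N.
    rewrite /E -sum1dep_card.
    rewrite -(pair_big_dep xpredT (fun i j => M i j != 0) (fun _ _ => 1%N))/=.
    by apply: eq_bigr => i _; rewrite sum1dep_card.
  (* Each row in [B] has at least [t.+1] nonzero entries; with [E < t.+1 ^ 2] this gives
     [#|B| < t.+1]. *)
  have BE : (#|B| * t.+1 <= E)%N.
    rewrite -sum_nat_const sE [leqRHS](bigID (mem B))/=.
    apply: leq_trans (leq_addr _ _); apply: leq_sum => i.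
    by rewrite inE.
  have := leq_ltn_trans BE ltE.
  by rewrite -mulnn ltn_pmul2r.
have cardC : (#|C| <= \rank M * t)%N.
  apply: (@leq_trans (\rank (D *m M) * t)%N).
    apply: card_support_rank => i.
    have [iB|iB] := boolP (i \in B).
      by rewrite eq_card0 // => j; rewrite inE DM iB mul0r eqxx.
    apply: leq_trans (_ : deg i <= t)%N; last by move: iB; rewrite inE -leqNgt.
    by apply: subset_leq_card; apply/fintype.subsetP => j; rewrite !inE DM iB mul1r.
  by rewrite leq_mul2r mxrankM_maxr orbT.
exists (B :|: C); split.
  apply: leq_trans (_ : ((\rank M).+1 * t) ^ 2 <= _)%N.
    by rewrite leq_exp2r// (leq_trans (leq_card_setU _ _))// mulSn leq_add.
  by rewrite expnMn leq_mul2l leE orbT.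
(* A nonzero [M i j] with [i] outside [B] survives in [D *m M] and puts [j] in [C]. *)
move=> i j; rewrite !inE !negb_or => /andP[iB _] /andP[_ jC].
apply/eqP; apply: contraNT jC => Mij; apply/existsP; exists i.
by rewrite DM inE iB mul1r.
Qed.

Definition stack {K : fieldType} {m : nat} (d : nat)
    (U W : {vspace 'rV[K]_m}) : 'M[K]_m :=
  \matrix_(k, l) (if (k < d)%N then (vbasis U)`_k 0 l
                  else (vbasis W)`_(k - d) 0 l).

(** The rows are the two bases concatenated, and these are free exactly when the sum of [U] and [W]
    is direct. *)
Lemma det_stack_neq0 (K : fieldType) (m d : nat) (U W : {vspace 'rV[K]_m}) :
  \dim U = d -> \dim W = d -> m = (d + d)%N ->
  (\det (stack d U W) != 0) = ((U :&: W)%VS == 0%VS).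
Proof.
move=> dU dW em.
pose X := vbasis U ++ vbasis W.
have sX : size X == m by rewrite size_cat !size_tuple dU dW em.
have sU : size (vbasis U) = d by rewrite size_tuple.
have rX (k : 'I_m) : row k (stack d U W) = X`_k.
  rewrite nth_cat sU; apply/rowP => l; rewrite !mxE.
  by case: ifP.
have -> : ((U :&: W)%VS == 0%VS) = free X.
  rewrite cat_free !(basis_free (vbasisP _))/= !(span_basis (vbasisP _)).
  by apply/eqP/directv_addP.
apply/idP/idP.
  (* In both directions, a left kernel vector of the matrix is read as a linear relation among its
     rows. *)
  move=> det0; apply/(@freeP _ _ _ (Tuple sX)) => c sc i.
  apply/eqP; apply: contraNT det0 => ci; apply/det0P; exists (\row_k c k).
    by apply: contraNneq ci => /rowP/(_ i); rewrite !mxE => ->.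
  by rewrite mulmx_sum_row -[RHS]sc; apply: eq_bigr => k _; rewrite mxE rX.
move/(@freeP _ _ _ (Tuple sX)) => fX; apply/det0P => -[v v0].
rewrite mulmx_sum_row => sv; case/eqP: v0; apply/rowP => i; rewrite mxE.
by apply: (fX (v 0)); rewrite -[RHS]sv; apply: eq_bigr => k _; rewrite rX.
Qed.

(** Row [k] of the stack depends on [U] alone for [k < d] and on [W] alone otherwise, so the Leibniz
    sum is a matrix product whose inner index runs over the permutations. *)
Lemma rank_det_stack (K : fieldType) (m d n : nat)
    (U W : 'I_n -> {vspace 'rV[K]_m}) :
  (\rank (\matrix_(i, j) \det (stack d (U i) (W j))) <= #|{perm 'I_m}|)%N.
Proof.
pose sg (s : 'I_#|{perm 'I_m}|) : {perm 'I_m} := enum_val s.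
pose A : 'M[K]_(n, #|{perm 'I_m}|) := \matrix_(i, s)
  ((-1) ^+ sg s * \prod_(k < m | (k < d)%N)
     (vbasis (U i))`_k 0 (sg s k)).
pose B : 'M[K]_(#|{perm 'I_m}|, n) := \matrix_(s, j)
  \prod_(k < m | ~~ (k < d)%N)
     (vbasis (W j))`_(k - d) 0 (sg s k).
have -> : (\matrix_(i, j) \det (stack d (U i) (W j))) = A *m B.
  apply/matrixP => i j; rewrite !mxE /determinant big_enum_val.
  apply: eq_bigr => s _; rewrite !mxE -mulrA; congr (_ * _).
  rewrite (bigID (fun k : 'I_m => (k < d)%N))/=; congr (_ * _).
    by apply: eq_bigr => k kd; rewrite mxE kd.
  by apply: eq_bigr => k /negbTE kd; rewrite mxE kd.
exact: mulmx_max_rank.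
Qed.

Local Open Scope classical_set_scope.

(** A flat can be based at any of its points; here both are rebased at the common point [x]. *)
Lemma flatI_at (R : realType) (m : nat) (p q x : 'rV[R]_m)
    (U W : {vspace 'rV[R]_m}) : x - p \in U -> x - q \in W ->
  [set y | y - p \in U] `&` [set y | y - q \in W] =
  [set y | y - x \in (U :&: W)%VS].
Proof.
move=> xU xW.
have memE (V : {vspace _}) r y : x - r \in V -> (y - r \in V) = (y - x \in V :> bool).
  by move=> xV; rewrite -(subrKA x) rpredDr.
apply/seteqP; split => y /=; rewrite (memE U)// (memE W)// memv_cap.
  by move=> [-> ->].
by move=> /andP[].
Qed.

(** The directions span the space, so [q - p = u + w] with [u] in [U] and [w] in [W]; then
    [p + u = q - w] is a common point. *)
Lemma flatI_dim0 (R : realType) (d : nat) (p q : 'rV[R]_(2 * d))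
    (U W : {vspace 'rV[R]_(2 * d)}) : \dim U = d -> \dim W = d ->
  (U :&: W)%VS = 0%VS ->
  is_flat 0 ([set y | y - p \in U] `&` [set y | y - q \in W]).
Proof.
move=> dU dW UW.
have full : (U + W)%VS = fullv.
  apply/eqP; rewrite eqEdim subvf dimvf/= dimv_disjoint_sum// dU dW.
  by rewrite /dim/= mul1n mul2n addnn.
have /memv_addP[u uU [w wW pq]] : q - p \in (U + W)%VS by rewrite full memvf.
exists (p + u), 0%VS; split; first by rewrite dimv0.
have e : p + u = q - w.
  by apply/eqP; rewrite eq_sym subr_eq -addrA -pq addrC subrK.
rewrite -UW; apply: flatI_at; first by rewrite addrC addKr.
by rewrite e addrC addKr rpredN.
Qed.

(** The ordered pairs split into those with [i < j], mirror images of such pairs, and at most [n]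
    diagonal ones, on which [r] may also hold. *)
Lemma card_ordered_pairs_le (n : nat) (r : rel 'I_n) (q : pred ('I_n * 'I_n)) :
  (forall i j, i != j -> r i j -> q (i, j) /\ q (j, i)) ->
  (#|[set ij : 'I_n * 'I_n | r ij.1 ij.2]%SET| <=
   2 * #|[pred ij : 'I_n * 'I_n | (ij.1 < ij.2)%N && q ij]| + n)%N.
Proof.
move=> rq.
pose P := [set ij : 'I_n * 'I_n | (ij.1 < ij.2)%N && q ij]%SET.
pose sw (ij : 'I_n * 'I_n) := (ij.2, ij.1).
have -> : #|[pred ij : 'I_n * 'I_n | (ij.1 < ij.2)%N && q ij]| = #|P|.
  by rewrite cardsE.
apply: (@leq_trans #|P :|: [set sw ij | ij in P] :|: [set (i, i) | i : 'I_n]|%SET).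
  apply/subset_leq_card/fintype.subsetP => -[i j]; rewrite !inE/= => rij.
  have [<-|ij] := eqVneq i j; first by rewrite imset_f ?orbT.
  have [qij qji] := rq _ _ ij rij.
  case: (ltngtP i j) => [lt|gt|/val_inj eij]; last by rewrite eij eqxx in ij.
    by rewrite qij.
  rewrite (_ : (i, j) = sw (j, i))// imset_f ?orbT//.
  by rewrite inE/= gt qji.
rewrite (leq_trans (leq_card_setU _ _))// leq_add//.
  rewrite (leq_trans (leq_card_setU _ _))// mul2n -addnn leq_add2l.
  exact: leq_imset_card.
by rewrite (leq_trans (leq_imset_card _ _))// card_ord.
Qed.

Lemma cvg_sqrt_div (R : realType) (c : R) (f : nat -> R) :
  f n / n%:R ^+ 2 @[n --> \oo] --> (0 : R) ->
  c * Num.sqrt (2 * f n + n%:R) / n%:R @[n --> \oo] --> (0 : R).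
Proof.
move=> hf.
have invn : (n%:R^-1 : R) @[n --> \oo] --> (0 : R).
  by rewrite -cvg_shiftS; exact: cvg_harmonic.
have h0 : (2 * (f n / n%:R ^+ 2) + n%:R^-1 : R) @[n --> \oo] --> (0 : R).
  have -> : (0 : R) = 2 * 0 + 0 by rewrite mulr0 addr0.
  by apply: cvgD => //; apply: cvgM => //; exact: cvg_cst.
have -> : (fun n => c * Num.sqrt (2 * f n + n%:R) / n%:R) =
    (fun n => c * Num.sqrt (2 * (f n / n%:R ^+ 2) + n%:R^-1)).
  apply/funext => n; case: n => [|n].
    (* At [n = 0] both sides are 0, because the inverse of 0 is 0. *)
    by rewrite !invr0 mulr0 expr0n invr0 !mulr0 addr0 sqrtr0 mulr0.
  have n0 : n.+1%:R != 0 :> R by rewrite pnatr_eq0.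
  have -> : 2 * (f n.+1 / n.+1%:R ^+ 2) + n.+1%:R^-1 =
     (n.+1%:R^-1) ^+ 2 * (2 * f n.+1 + n.+1%:R).
    by field; rewrite nat1r n0.
  by rewrite sqrtrM ?sqr_ge0// sqrtr_sqr ger0_norm ?invr_ge0//
    -mulrA [_ / _]mulrC.
have -> : (0 : R) = c * Num.sqrt 0 by rewrite sqrtr0 mulr0.
apply: cvgM; first exact: cvg_cst.
by apply: continuous_cvg h0; exact: sqrt_continuous.
Qed.

Theorem theorem5 (R : realType) (d : nat) (f : nat -> R)
    (hf : f n / n%:R ^+ 2 @[n --> \oo] --> (0 : R)) :
  exists g : nat -> R,
    (g n / n%:R @[n --> \oo] --> (0 : R)) /\
    forall (n : nat) (F : 'I_n -> set 'rV[R]_(2 * d)),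
      (forall i : 'I_n, is_flat d (F i)) ->
      (forall i j : 'I_n, i != j -> ~ parallel (F i) (F j)) ->
      (point_pairs F)%:R <= f n ->
      exists S : {set 'I_n},
        #|S|%:R <= g n /\
        forall i j : 'I_n, i \notin S -> j \notin S -> i != j ->
          F i `&` F j !=set0 ->
          exists2 k : nat, (1 <= k)%N & is_flat k (F i `&` F j).
Proof.
pose N := #|{perm 'I_(2 * d)}|.
(* [N] bounds the rank of the determinant matrix, and [2 * f n + n] bounds the number of its nonzero
   entries. *)
exists (fun n => N.+1%:R * Num.sqrt (2 * f n + n%:R)).
split; first exact: cvg_sqrt_div.
move=> n F flatF _ hF.
have /choice[p /choice[U pU]] := flatF.
have dU i : \dim (U i) = d by have [] := pU i.
have FE i : F i = [set x | x - p i \in U i] by have [] := pU i.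
pose M := \matrix_(i, j) \det (stack d (U i) (U j)).
have M0 i j : (M i j != 0) = ((U i :&: U j)%VS == 0%VS).
  by rewrite mxE det_stack_neq0// mul2n addnn.
have [S [cardS MS]] := sparse_low_rank_removal _ _ M.
exists S; split.
  have E : (#|[set ij : 'I_n * 'I_n | M ij.1 ij.2 != 0%R]%SET| <=
            2 * point_pairs F + n)%N.
    apply: (card_ordered_pairs_le _ (fun i j => M i j != 0)
      (fun ij => `[< is_flat 0 (F ij.1 `&` F ij.2) >])) => i j _.
    rewrite M0 => /eqP Uij; split; apply/asboolP; rewrite /= !FE.
      exact: flatI_dim0.
    by apply: flatI_dim0; rewrite // capvC.
  have S2 : (#|S| ^ 2 <= N.+1 ^ 2 * (2 * point_pairs F + n))%N.
    by rewrite (leq_trans cardS)// leq_mul// leq_exp2r// ltnS rank_det_stack.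
  (* [f n] is at least a natural number here, so the square root is not the default value 0 taken on
     negatives. *)
  have h0 : 0 <= 2 * f n + n%:R.
    by rewrite addr_ge0// mulr_ge0// (le_trans _ hF).
  rewrite -(@ler_pXn2r _ 2) ?nnegrE ?mulr_ge0 ?sqrtr_ge0// exprMn sqr_sqrtr//.
  apply: (@le_trans _ _ (N.+1 ^ 2 * (2 * point_pairs F + n))%:R).
    by rewrite -natrX ler_nat.
  by rewrite natrM natrX natrD natrM ler_wpM2l ?exprn_ge0// lerD2r ler_wpM2l.
(* [M i j = 0] gives the two directions a nonzero common vector, and the common point [x] makes the
   intersection a flat along [U i :&: U j]. *)
move=> i j iS jS _ [x [xi xj]]; exists (\dim (U i :&: U j)).
  by rewrite lt0n dimv_eq0 -M0 MS ?eqxx.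
exists x, (U i :&: U j)%VS; split => //.
by rewrite !FE in xi xj *; exact: flatI_at.
Qed.
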